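(* Let $n\ge 1$ be an integer, let $q$ be a prime power, and let $P$ be a given poset or configuration. Suppose that there exists a number $c(P)$ such that every family $\mathcal{F}\subseteq 2^{[n]}$ which does not contain $P$ satisfies $l(\mathcal{F})\le c(P)$. Then every family $\mathcal{V}$ of subspaces of $\mathbb{F}_q^n$ which contains no copy of $P$ satisfies $$l_q(\mathcal{V})=\sum_{V\in\mathcal{V}}\frac{1}{\binom{n}{\dim V}_q}\le c(P).$$
   Context: $[n]=\{1,\dots,n\}$, and $\mathcal{B}_n=2^{[n]}$ is the Boolean lattice of all subsets of $[n]$ ordered by inclusion. $\mathcal{L}_n(q)$ is the linear lattice of all subspaces of $\mathbb{F}_q^n$ ordered by inclusion. $\binom{n}{k}_q=\prod_{0\le i\le k-1}\frac{q^{n-i}-1}{q^{k-i}-1}$ is the Gaussian binomial coefficient (the number of $k$-dimensional subspaces of $\mathbb{F}_q^n$). The Lubell function of $\mathcal{F}\subseteq 2^{[n]}$ is $l(\mathcal{F})=\sum_{F\in\mathcal{F}}1/\binom{n}{|F|}$. For a family $\mathcal{V}$ of subspaces of $\mathbb{F}_q^n$, $l_q(\mathcal{V})=\sum_{V\in\mathcal{V}}1/\binom{n}{\dim V}_q=\sum_{i=0}^n|\mathcal{V}_i|/\binom{n}{i}_q$, where $\mathcal{V}_i=\{V\in\mathcal{V}:\dim V=i\}$. Containment of $P$. If $P$ is a poset, a family $\mathcal{F}$ (of subsets or of subspaces, ordered by inclusion) contains $P$ weakly if there is an injective map $\psi:P\to\mathcal{F}$ such that $u\le_P v$ implies $\psi(u)\subseteq\psi(v)$,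 and strongly if there is an injective $\psi:P\to\mathcal{F}$ such that $u\le_P v$ if and only if $\psi(u)\subseteq\psi(v)$; the theorem is for either notion, the same one being used for subsets and for subspaces. More generally, a configuration $P$ is a pattern that makes sense both in $\mathcal{B}_n$ and in $\mathcal{L}_n(q)$: certain subfamilies of $2^{[n]}$ and certain subfamilies of $\mathcal{L}_n(q)$ are designated as copies of $P$, in such a way that for every basis $\{v_1,\dots,v_n\}$ of $\mathbb{F}_q^n$ the (inclusion- and intersection-preserving) map $H\mapsto \mathrm{span}\{v_x: x\in H\}$, $H\subseteq[n]$, sends copies of $P$ in $2^{[n]}$ to copies of $P$ in $\mathcal{L}_n(q)$. A family contains $P$ if some subfamily of it is a copy of $P$. (Example: $s$ pairwise disjoint members, where subspaces are disjoint if they intersect in $\{0\}$.) *)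

(* Defs.v *)
From HB Require Import structures.
From mathcomp Require Import all_boot all_order all_algebra.

Set Implicit Arguments.
Unset Strict Implicit.
Unset Printing Implicit Defensive.

Import Order.TTheory GRing.Theory Num.Theory.
Local Open Scope ring_scope.

(* MathComp only makes {vspace vT} a choiceType. Over a finite field it has
   finitely many elements, so families of subspaces can be taken in {set _}. *)
Section FinVspace.
Import VectorInternalTheory.
Variables (F : finFieldType) (vT : vectType F).
HB.instance Definition _ := [Countable of {vspace vT} by <:].
HB.instance Definition _ := [Finite of {vspace vT} by <:].
End FinVspace.

Section Lubell.
Variable R : realFieldType.

(* The truncated subtractions are exact whenever k <= n. *)
Definition gauss_binom (q n k : nat) : R :=
  \prod_(0 <= i < k) ((q%:R ^+ (n - i) - 1) / (q%:R ^+ (k - i) - 1)).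

Definition lubell (n : nat) (A : {set {set 'I_n}}) : R :=
  \sum_(X in A) ('C(n, #|X|)%:R)^-1.

Definition lubell_lin (F : finFieldType) (n : nat)
    (V : {set {vspace 'rV[F]_n}}) : R :=
  \sum_(U in V) (gauss_binom #|F| n (\dim U))^-1.

End Lubell.

Definition contains_weakly (d : Order.disp_t) (P : porderType d)
    (T : finType) (le : rel T) (A : {set T}) : Prop :=
  exists psi : P -> T,
    [/\ injective psi, forall u, psi u \in A
      & forall u v : P, (u <= v)%O -> le (psi u) (psi v)].

Definition contains_strongly (d : Order.disp_t) (P : porderType d)
    (T : finType) (le : rel T) (A : {set T}) : Prop :=
  exists psi : P -> T,
    [/\ injective psi, forall u, psi u \in A
      & forall u v : P, (u <= v)%O <-> le (psi u) (psi v)].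

Definition set_span (F : finFieldType) (n : nat) (v : n.-tuple 'rV[F]_n)
    (H : {set 'I_n}) : {vspace 'rV[F]_n} :=
  <<[seq tnth v x | x in H]>>%VS.

Record configuration (F : finFieldType) (n : nat) := Configuration {
  set_copy : {set {set 'I_n}} -> Prop;
  lin_copy : {set {vspace 'rV[F]_n}} -> Prop;
  copy_span : forall v : n.-tuple 'rV[F]_n, basis_of fullv v ->
    forall A : {set {set 'I_n}}, set_copy A -> lin_copy (set_span v @: A)
}.

(* A forbidden pattern carries its notion of containment, so that the same one
   is used for subsets and for subspaces. *)
Inductive pattern (F : finFieldType) (n : nat) :=
| WeakPoset (d : Order.disp_t) (P : porderType d)
| StrongPoset (d : Order.disp_t) (P : porderType d)
| Config (C : configuration F n).

Definition set_contains (F : finFieldType) (n : nat) (P : pattern F n)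
    (A : {set {set 'I_n}}) : Prop :=
  match P with
  | WeakPoset _ Q => contains_weakly Q (fun X Y : {set 'I_n} => X \subset Y) A
  | StrongPoset _ Q =>
      contains_strongly Q (fun X Y : {set 'I_n} => X \subset Y) A
  | Config C => exists2 B : {set {set 'I_n}}, B \subset A & set_copy C B
  end.

Definition lin_contains (F : finFieldType) (n : nat) (P : pattern F n)
    (V : {set {vspace 'rV[F]_n}}) : Prop :=
  match P with
  | WeakPoset _ Q =>
      contains_weakly Q (fun U W : {vspace 'rV[F]_n} => (U <= W)%VS) V
  | StrongPoset _ Q =>
      contains_strongly Q (fun U W : {vspace 'rV[F]_n} => (U <= W)%VS) V
  | Config C =>
      exists2 B : {set {vspace 'rV[F]_n}}, B \subset V & lin_copy C B
  end.

(* Main.v *)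
(* Average over the ordered bases [v] of F^n.  For each basis, the family of the
   sets [H] with [set_span v H \in V] does not contain P, so its Lubell function
   is at most c.  If |H| = dim U, then the proportion of bases with
   [set_span v H = U] is 1 / gauss_binom q n (dim U), whatever H is; hence the
   average of these Lubell functions is exactly [lubell_lin R V]. *)

Require Import Defs.
From mathcomp Require Import all_boot all_order all_algebra.
From mathcomp Require Import finfield.

Set Implicit Arguments.
Unset Strict Implicit.
Unset Printing Implicit Defensive.

Import Order.TTheory GRing.Theory Num.Theory.
Local Open Scope ring_scope.

Lemma card_tuple_cons (T : finType) (m : nat) (p : pred (seq T)) :
  #|[set t : m.+1.-tuple T | p t]| =
  (\sum_x #|[set t : m.-tuple T | p (x :: t)]|)%N.
Proof.
rewrite -sum1_card.
under [RHS]eq_bigr => x _ do rewrite -sum1_card.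
rewrite pair_big_dep /=.
rewrite (reindex (fun xt : T * m.-tuple T => cons_tuple xt.1 xt.2)) /=.
  by apply: eq_bigl => -[x t]; rewrite !inE.
exists (fun t : m.+1.-tuple T => (thead t, behead_tuple t)) => [[x t]|t] _ /=.
  by congr (_, _); apply: val_inj.
by rewrite [RHS]tuple_eta; apply: val_inj.
Qed.

Section FreeTuples.
Variables (F : finFieldType) (n : nat).
Local Notation vT := 'rV[F]_n.
Local Notation q := #|F|.

(** The i-th vector is constrained to the i-th subspace; that the subspaces increase is a separate
    [path] hypothesis. *)
Let in_flag (t : seq vT) (Us : seq {vspace vT}) :=
  all2 (fun (x : vT) (U : {vspace vT}) => x \in U) t Us.

(** Choose the vectors in turn: the i-th must lie in the i-th subspace but outside the span of the
    earlier ones. As the flag increases, it contains that span, whose dimension is [size s + i], so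
    the number of choices does not depend on the earlier ones. *)
Lemma card_free_extension (Us : seq {vspace vT}) (m : nat) (s : seq vT) :
  size Us = m -> free s -> path subsetv <<s>>%VS Us ->
  #|[set t : m.-tuple vT | free (s ++ t) && in_flag t Us]| =
  (\prod_(i < m) (q ^ \dim (nth fullv Us i) - q ^ (size s + i)))%N.
Proof.
elim: Us m s => [|U Us IHUs] [|m] s //= => [_|[sz_Us]] free_s.
  move=> _; rewrite big_ord0 -[RHS](expn0 #|{: vT}|) -(card_tuple 0 vT).
  by apply: eq_card => t; rewrite !inE tuple0 cats0 free_s.
case/andP=> sU pathU.
rewrite (card_tuple_cons _ (fun t => free (s ++ t) && in_flag t (U :: Us))) /=.
rewrite big_ord_recl /= addn0.
under [in RHS]eq_bigr => i _ do rewrite /bump /= add1n addnS -addSn.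
set p := (\prod_(i < m) _)%N.
(* Freeness makes [size s] the dimension of [<<s>>], so the first factor counts the vectors of [U]
   outside [<<s>>]. *)
rewrite -(eqnP free_s).
rewrite -!card_vspace -cardsE -[in X in (_ - X)%N]cardsE.
rewrite -cardsDS; last first.
  by apply/subsetP=> x; rewrite !inE; apply: (subvP sU).
rewrite -sum1_card big_distrl /= [RHS]big_mkcond /=.
apply: eq_bigr => x _; rewrite !inE mul1n.
(* Freeness ignores order, so [x] can join the prefix [s] for the induction. *)
have permE t : perm_eq (s ++ x :: t) ((x :: s) ++ t).
  by rewrite -cat1s perm_catCA.
case: ifP => [/andP[s'x Ux]|s'xU].
  have := IHUs m (x :: s) sz_Us; rewrite /= -/p => <-.
  - by apply: eq_card => t; rewrite !inE (perm_free (permE t)) Ux.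
  - by rewrite free_cons s'x.
  - case: (Us) pathU => //= W Ws /andP[UW ->]; rewrite andbT.
    apply: subv_trans UW; rewrite span_cons subv_add sU andbT.
    by rewrite -memvE.
(* A vector in [<<s>>] or outside [U] starts no admissible tuple. *)
apply/eqP; rewrite cards_eq0 -subset0; apply/subsetP=> t; rewrite !inE.
rewrite (perm_free (permE t)) /= -cat_cons => /and3P[/catl_free].
by rewrite free_cons => /andP[s'x _] Ux; rewrite s'x Ux in s'xU.
Qed.

Let in_flag_nseq (U : {vspace vT}) (t : seq vT) (m : nat) :
  size t = m -> in_flag t (nseq m U) = all [in U] t.
Proof. by move=> <-; elim: t => //= x t <-. Qed.

Let in_flag_cat t1 t2 Us1 Us2 : size t1 = size Us1 ->
  in_flag (t1 ++ t2) (Us1 ++ Us2) = in_flag t1 Us1 && in_flag t2 Us2.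
Proof. by elim: t1 Us1 => [|x t IHt] [|U Us] //= [/IHt->]; rewrite andbA. Qed.

Let path_nseq (U W : {vspace vT}) (m : nat) :
  (U <= W)%VS -> path subsetv U (nseq m W).
Proof. by elim: m U => //= m IHm U ->; apply: IHm; apply: subvv. Qed.

Let dim_rV : \dim {: vT} = n.
Proof. by rewrite dimvf /dim /= mul1n. Qed.

Lemma basis_of_fullvE (v : n.-tuple vT) : basis_of fullv v = free v.
Proof. by rewrite basisEfree subvf size_tuple dim_rV leqnn !andbT. Qed.

Lemma card_bases :
  #|[set v : n.-tuple vT | basis_of fullv v]| =
  (\prod_(i < n) (q ^ n - q ^ i))%N.
Proof.
pose Us := nseq n (fullv : {vspace vT}).
transitivity #|[set t : n.-tuple vT | free ([::] ++ t) && in_flag t Us]|.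
  apply: eq_card => v; rewrite !inE basis_of_fullvE in_flag_nseq ?size_tuple //.
  by rewrite [all _ _](introT allP) ?andbT // => x _; apply: memvf.
rewrite card_free_extension ?size_nseq ?nil_free //.
  by apply: eq_bigr => i _; rewrite nth_nseq ltn_ord dim_rV.
by rewrite span_nil path_nseq ?sub0v.
Qed.

Lemma free_map_tnth (v : n.-tuple vT) (s : seq 'I_n) :
  free v -> uniq s -> free [seq tnth v x | x <- s].
Proof.
move=> free_v uniq_s.
(* Adding the remaining indices completes [s] to a permutation of all of them, and part of a free
   family is free. *)
have perm_s : perm_eq s (filter [in s] (enum 'I_n)).
  apply: uniq_perm => [||x] //; first by rewrite filter_uniq ?enum_uniq.
  by rewrite mem_filter mem_enum inE andbT.
rewrite (perm_free (perm_map _ perm_s)).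
apply: (@catl_free _ _ [seq tnth v x | x <- filter (predC [in s]) (enum 'I_n)]).
rewrite -map_cat (perm_free (perm_map _ (permEl (perm_filterC _ _)))).
by rewrite map_tnth_enum.
Qed.

Lemma dim_set_span (v : n.-tuple vT) (H : {set 'I_n}) :
  basis_of fullv v -> \dim (set_span v H) = #|H|.
Proof.
rewrite basis_of_fullvE => free_v.
have /eqnP-> : free [seq tnth v x | x in H] by rewrite free_map_tnth ?enum_uniq.
by rewrite size_map -cardE.
Qed.

(** If [x] is not in [Y], then [tnth v x] is independent of the vectors indexed by [Y], hence
    outside their span. *)
Lemma set_span_subE (v : n.-tuple vT) (X Y : {set 'I_n}) :
  basis_of fullv v -> (set_span v X <= set_span v Y)%VS = (X \subset Y).
Proof.
rewrite basis_of_fullvE => free_v; apply/idP/idP => [sXY|/subsetP sXY].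
  apply/subsetP=> x Xx; apply: contraT => Y'x.
  have: free [seq tnth v y | y <- x :: enum Y].
    by rewrite free_map_tnth //= mem_enum Y'x enum_uniq.
  rewrite /= free_cons => /andP[/negP v'x _]; case: v'x.
  by apply: (subvP sXY); rewrite memv_span // image_f.
apply: sub_span => _ /imageP[x /sXY Yx ->]; exact: image_f.
Qed.

Lemma set_span_inj (v : n.-tuple vT) :
  basis_of fullv v -> injective (set_span v).
Proof.
move=> basis_v X Y eqXY; apply/eqP.
by rewrite eqEsubset -!(set_span_subE _ _ basis_v) eqXY subvv.
Qed.

(* Listing H first moves the condition [set_span v H = U] to the flag made of
   #|H| copies of U followed by the whole space. *)
Lemma card_bases_span (H : {set 'I_n}) (U : {vspace vT}) :
  \dim U = #|H| ->
  #|[set v : n.-tuple vT | basis_of fullv v && (set_span v H == U)]| =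
  (\prod_(i < n) (q ^ (if i < #|H| then #|H| else n) - q ^ i))%N.
Proof.
move=> dimU; have leHn : (#|H| <= n)%N by rewrite -[n in (_ <= n)%N]card_ord max_card.
pose s := enum H ++ enum (~: H).
have perm_s : perm_eq s (enum 'I_n).
  apply: uniq_perm => [||x]; rewrite ?enum_uniq //.
    rewrite cat_uniq !enum_uniq andbT; apply/hasPn => x.
    by rewrite !mem_enum inE.
  by rewrite mem_cat !mem_enum !inE orbN.
have size_s : size s == n by rewrite (perm_size perm_s) size_enum_ord.
pose e := Tuple size_s.
pose f (v : n.-tuple vT) := map_tuple (tnth v) e.
have f_inj : injective f.
  move=> v w /(congr1 val)/= /eq_in_map eq_vw; apply: eq_from_tnth => x.
  by apply: eq_vw; rewrite (perm_mem perm_s) mem_enum.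
pose Us := nseq #|H| U ++ nseq (n - #|H|) fullv.
transitivity #|[set t : n.-tuple vT | free ([::] ++ t) && in_flag t Us]|.
  (* Reordering the entries by [e] is injective on a finite type, hence bijective, so passing to the
     preimage keeps the cardinality. *)
  rewrite -[RHS](card_preimset _ f_inj); apply: eq_card => v; rewrite !inE.
  rewrite basis_of_fullvE /= (perm_free (perm_map _ perm_s)) map_tnth_enum.
  case free_v: (free v) => //=.
  have sz1 : size [seq tnth v x | x in H] = #|H| by rewrite size_map -cardE.
  rewrite /s map_cat in_flag_cat ?size_nseq // !in_flag_nseq //; last first.
    by rewrite size_map -cardE [LHS]cardsCs setCK card_ord.
  rewrite [X in _ && X](introT allP) ?andbT; last by move=> x _; apply: memvf.
  (* The dimensions agree, so equality with [U] reduces to inclusion. *)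
  rewrite eqEdim dim_set_span ?basis_of_fullvE // dimU leqnn andbT.
  by apply/span_subvP/allP.
rewrite card_free_extension ?nil_free //.
- apply: eq_bigr => i _; rewrite nth_cat size_nseq !nth_nseq.
  (* The default of [nth] is also [fullv], so the two branches of [nth_nseq] coincide. *)
  by case: (i < #|H|)%N; rewrite ?dimU // if_same dim_rV.
- by rewrite size_cat !size_nseq subnKC.
by rewrite span_nil cat_path !path_nseq ?sub0v ?subvf.
Qed.

End FreeTuples.

(** The factors with [i >= k] agree on both sides. For [i < k], taking [q ^ i] out of
    [q ^ k - q ^ i] and [q ^ n - q ^ i] leaves the ratio of the i-th factor of the inverse Gaussian
    binomial. *)
Lemma ratio_card_bases (R : realFieldType) (q n k : nat) :
  (1 < q)%N -> (k <= n)%N ->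
  (\prod_(i < n) (q ^ (if i < k then k else n) - q ^ i))%N%:R =
  (gauss_binom R q n k)^-1 * (\prod_(i < n) (q ^ n - q ^ i))%N%:R.
Proof.
move=> q_gt1 le_kn; have q_neq0 : q%:R != 0 :> R by rewrite pnatr_eq0 -lt0n ltnW.
have expB1 m i : (i < m)%N ->
    (q ^ m - q ^ i)%N%:R = q%:R ^+ i * (q%:R ^+ (m - i) - 1) :> R.
  move=> ltim; rewrite natrB ?leq_exp2l ?(ltnW ltim) // !natrX.
  by rewrite mulrBr mulr1 -exprD subnKC // ltnW.
have exp1_neq0 m i : (i < m)%N -> q%:R ^+ (m - i) - 1 != 0 :> R.
  by move=> ltim; rewrite subr_eq0 gt_eqF // exprn_egt1 ?ltr1n // -lt0n subn_gt0.
rewrite -(big_mkord xpredT (fun i => q ^ (if i < k then k else n) - q ^ i)%N).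
rewrite -(big_mkord xpredT (fun i => q ^ n - q ^ i)%N).
rewrite !(big_cat_nat (leq0n k) le_kn) /= !natrM mulrA; congr (_ * _); last first.
  by congr _%:R; apply: eq_big_nat => i /andP[le_ki _]; rewrite ltnNge le_ki.
rewrite /gauss_binom -prodfV !natr_prod -big_split /=.
apply: eq_big_nat => i /andP[_ lt_ik]; have lt_in := leq_trans lt_ik le_kn.
rewrite lt_ik !expB1 // invf_div mulrCA; congr (_ * _).
by rewrite divfK ?exp1_neq0.
Qed.

(** Double counting of the pairs of a basis [v] and a set [H] with [set_span v H] in [V], each
    weighted by ['C(n, #|H|)%:R^-1]. *)
Lemma lubell_linE (R : realFieldType) (F : finFieldType) (n : nat)
    (V : {set {vspace 'rV[F]_n}}) :
  lubell_lin R V * #|[set v : n.-tuple 'rV[F]_n | basis_of fullv v]|%:R =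
  \sum_(v : n.-tuple 'rV[F]_n | basis_of fullv v)
    lubell R (set_span v @^-1: V).
Proof.
rewrite /lubell_lin mulr_suml.
pose N H U := #|[set v : n.-tuple 'rV[F]_n |
                  basis_of fullv v && (set_span v H == U)]|.
transitivity (\sum_(U in V) \sum_(H : {set 'I_n}) 'C(n, #|H|)%:R^-1 * (N H U)%:R : R).
  apply: eq_bigr => U _; have dimUn : (\dim U <= n)%N.
    by rewrite (leq_trans (dimvS (subvf U))) // dimvf /dim /= mul1n.
  rewrite [RHS](bigID (fun H : {set 'I_n} => #|H| == \dim U)) /=.
  (* Since [set_span v H] has dimension [#|H|], sets of any other size never span [U]. *)
  rewrite [X in _ + X]big1 ?addr0 => [|H neHU]; last first.
    rewrite [N H U](_ : _ = 0%N) ?mulr0 //; apply/eqP; rewrite cards_eq0.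
    apply/eqP/setP=> v; rewrite !inE; apply/negP => /andP[basis_v /eqP defU].
    by rewrite -defU dim_set_span ?eqxx in neHU.
  under eq_bigr => H /eqP cardH.
    rewrite /N card_bases_span // ratio_card_bases ?cardH ?finNzRing_gt1 //.
    rewrite -card_bases.
  over.
  (* The summand no longer depends on [H], and the number of sets of size [\dim U] cancels the
     binomial weight. *)
  rewrite -(eq_bigl _ _ (in_set (fun H : {set 'I_n} => #|H| == \dim U))).
  rewrite sumr_const card_draws card_ord.
  by rewrite -[RHS]mulr_natl mulVKf // pnatr_eq0 -lt0n bin_gt0.
rewrite exchange_big /=.
under [RHS]eq_bigr => v _ do rewrite /lubell big_mkcond /=.
rewrite [RHS]exchange_big /=; apply: eq_bigr => H _.
rewrite -mulr_sumr -big_mkcondr /= sumr_const -[RHS]mulr_natr; congr (_ * _).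
rewrite -natr_sum; congr _%:R.
(* For fixed [H], group the bases by the member of [V] that [H] spans. *)
rewrite -sum1_card (partition_big (fun v => set_span v H) [in V]) /=; last first.
  by move=> v /andP[_]; rewrite inE.
apply: eq_bigr => U VU; rewrite /N -sum1_card; apply: eq_bigl => v.
rewrite !inE -andbA; case: (set_span v H =P U) => [defU|]; last by rewrite !andbF.
by rewrite !andbT unfold_in inE defU VU andbT.
Qed.

(** For a basis [v], [set_span v] is injective and both preserves and reflects inclusion, so
    composing with it carries weak and strong copies over; for configurations this is
    [copy_span]. *)
Lemma lin_contains_set_span (F : finFieldType) (n : nat) (P : pattern F n)
    (v : n.-tuple 'rV[F]_n) (V : {set {vspace 'rV[F]_n}}) :
  basis_of fullv v -> set_contains P (set_span v @^-1: V) -> lin_contains P V.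
Proof.
move=> basis_v; case: P => [d P|d P|C] /=.
- case=> psi [psi_inj psiV psi_le]; exists (set_span v \o psi); split=> [||x y].
  + exact: inj_comp (set_span_inj basis_v) psi_inj.
  + by move=> x; have := psiV x; rewrite inE.
  + by move/psi_le; rewrite /= set_span_subE.
- case=> psi [psi_inj psiV psi_le]; exists (set_span v \o psi); split=> [||x y].
  + exact: inj_comp (set_span_inj basis_v) psi_inj.
  + by move=> x; have := psiV x; rewrite inE.
  + by rewrite /= set_span_subE.
- case=> B sBV copyB; exists (set_span v @: B); last exact: copy_span.
  by apply/subsetP=> _ /imsetP[X /(subsetP sBV) VX ->]; rewrite inE in VX.
Qed.

Theorem theorem1p9 (R : realFieldType) (n : nat) (hn : (1 <= n)%N)
    (F : finFieldType) (P : pattern F n) (c : R)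
    (hc : forall A : {set {set 'I_n}},
        ~ set_contains P A -> lubell R A <= c) :
  forall V : {set {vspace 'rV[F]_n}},
    ~ lin_contains P V -> lubell_lin R V <= c.
Proof.
move=> V V'P; set B := #|[set v : n.-tuple 'rV[F]_n | basis_of fullv v]|.
(* Each factor [q ^ n - q ^ i] with [i < n] is positive, so the inequality can be multiplied by the
   number of bases and compared basis by basis. *)
have B_gt0 : 0 < B%:R :> R.
  rewrite ltr0n /B card_bases prodn_gt0 // => i.
  by rewrite subn_gt0 ltn_exp2l ?finNzRing_gt1.
rewrite -(ler_pM2r B_gt0) lubell_linE mulr_natr /B -sumr_const.
rewrite (eq_bigl _ _ (in_set (fun v : n.-tuple 'rV[F]_n => basis_of fullv v))).
apply: ler_sum => v basis_v; apply: hc => v_contains; apply: V'P.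
exact: lin_contains_set_span v_contains.
Qed.
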